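(* Let $ABC$ be an anticlockwise oriented triangle and let a circle $\Gamma$ with centre $O$ meet the sides $BC$, $CA$, $AB$ at $\{A_1,A_2\}$, $\{B_1,B_2\}$, $\{C_1,C_2\}$ respectively. Let $P$ and $Q$ be the Miquel points of $\triangle A_1B_1C_1$ and $\triangle A_2B_2C_2$ in $\triangle ABC$, respectively, and put $T_A=PA_1\cap QA_2$, $T_B=PB_1\cap QB_2$, $T_C=PC_1\cap QC_2$. Let $A'$ be the second intersection (other than $A$) of $\odot(AB_1C_1)$ and $\odot(AB_2C_2)$, let $B'$ be the second intersection (other than $B$) of $\odot(BC_1A_1)$ and $\odot(BC_2A_2)$, and let $C'$ be the second intersection (other than $C$) of $\odot(CA_1B_1)$ and $\odot(CA_2B_2)$. Then the triangles $T_AT_BT_C$ and $A'B'C'$ are perspective, i.e. the lines $T_AA'$, $T_BB'$, $T_CC'$ are concurrent.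
   Context: All objects lie in the Euclidean plane; $\odot(XYZ)$ denotes the circumcircle of $\triangle XYZ$. The two labels on each side may be assigned in either order. Concurrency is understood in the projective plane, as is usual for perspective triangles. Miquel point: if $D,E,F$ lie on the lines $BC,CA,AB$ respectively, the Miquel point of $\triangle DEF$ in $\triangle ABC$ is the common point of $\odot(AEF)$, $\odot(BFD)$, $\odot(CDE)$. Coincidences are read in the limiting sense: if, e.g., $B_1=A\neq C_1$, then $\odot(AB_1C_1)$ means the circle through $A$ and $C_1$ tangent to line $CA$ at $A$ (and similarly in the other cases). The configuration is assumed nondegenerate, so that every named object exists and is uniquely determined: no circle above has all three of its defining points equal, the second intersections $A',B',C'$ exist, $P\neq Q$, $P\notin\{A_1,B_1,C_1\}$, $Q\notin\{A_2,B_2,C_2\}$, the pairs of lines defining $T_A,T_B,T_C$ are distinct and not parallel, and $T_A\ne A'$, $T_B\neq B'$, $T_C\neq C'$. *)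

(* Defs.v *)
From Stdlib Require Import Reals.
Open Scope R_scope.

Definition point : Type := (R * R)%type.

Definition dist (X Y : point) : R :=
  dist_euc (fst X) (snd X) (fst Y) (snd Y).

(* Twice the signed area of the triangle XYZ. *)
Definition area2 (X Y Z : point) : R :=
  (fst Y - fst X) * (snd Z - snd X) - (snd Y - snd X) * (fst Z - fst X).

Definition anticlockwise (X Y Z : point) : Prop := 0 < area2 X Y Z.

(* The line UV; a genuine line only when U <> V. *)
Definition line (U V : point) (X : point) : Prop := area2 U V X = 0.

(* Equality of directions: a line is parallel to itself here. *)
Definition parallel (U V X Y : point) : Prop :=
  (fst V - fst U) * (snd Y - snd X) - (snd V - snd U) * (fst Y - fst X) = 0.

Definition circle (O : point) (r : R) (X : point) : Prop := dist O X = r.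

(* S and S' meet exactly in {X, Y}.  If S is a circle
   and S' a line, then X = Y means tangency. *)
Definition meet_in (S S' : point -> Prop) (X Y : point) : Prop :=
  forall Z, S Z /\ S' Z <-> Z = X \/ Z = Y.

Definition tangent_at (S l : point -> Prop) (X : point) : Prop :=
  forall Z, S Z /\ l Z <-> Z = X.

(* The circle VYZ, where Y is a point of the line VU and Z a point of the line
   VW, with the limiting convention: when Y = V it touches VU at V, and when
   Z = V it touches VW at V.  [vertex_circle V U W Y Z X] says that X lies on
   it. *)
Definition vertex_circle (V U W Y Z : point) (X : point) : Prop :=
  exists (K : point) (r : R),
    0 < r /\
    circle K r V /\ circle K r Y /\ circle K r Z /\
    (Y = V -> tangent_at (circle K r) (line V U) V) /\
    (Z = V -> tangent_at (circle K r) (line V W) V) /\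
    circle K r X.

(* P is the Miquel point of DEF in ABC, for D, E, F on BC, CA, AB. *)
Definition miquel_point (A B C D E F P : point) : Prop :=
  vertex_circle A C B E F P /\
  vertex_circle B A C F D P /\
  vertex_circle C B A D E P.

Definition second_intersection (S S' : point -> Prop) (V X : point) : Prop :=
  X <> V /\ meet_in S S' V X.

Definition lines_intersection (U V X Y T : point) : Prop :=
  ~ parallel U V X Y /\ line U V T /\ line X Y T.

(* Concurrency in the projective plane of three lines, each given by two
   distinct points: a common point, or a common point at infinity. *)
Definition concurrent (U1 V1 U2 V2 U3 V3 : point) : Prop :=
  (exists X, line U1 V1 X /\ line U2 V2 X /\ line U3 V3 X) \/
  (parallel U1 V1 U2 V2 /\ parallel U2 V2 U3 V3 /\ parallel U3 V3 U1 V1).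

Definition perspective (X Y Z X' Y' Z' : point) : Prop :=
  concurrent X X' Y Y' Z Z'.

(* Main.v *)
(* Let theta be the common directed angle from BC, CA, AB to PA1, PB1, PC1 and
   t = cot theta; since A1A2, B1B2, C1C2 have the projections of O as midpoints,
   the corresponding angle for Q is - theta.  Hence O lies on the perpendicular
   bisector of PQ with angle POQ = 2 theta, and TA, TB, TC, A', B', C' lie on the
   circle OPQ.  If N is the antipode of O on it, then TA is the foot of the
   perpendicular from O to the parallel to BC through N, and A' the foot of the
   perpendicular from O to NA.  The equation of the chord joining the feet on two
   lines through N of directions p and q is bilinear and symmetric in (p, q), and
   (C - B)(A - N) + (A - C)(B - N) + (B - A)(C - N) = 0 for symmetric products
   (this is Desargues' involution in the pencil of N), so the three chords TA A',
   TB B', TC C' have linearly dependent equations. *)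
Require Import Defs.
From Stdlib Require Import Reals Lra.
Open Scope R_scope.

(** * Scalar and vector products; chords cut by a circle on a line *)

Definition inner (U V X Y : point) : R :=
  (fst V - fst U) * (fst Y - fst X) + (snd V - snd U) * (snd Y - snd X).

Definition cross (U V X Y : point) : R :=
  (fst V - fst U) * (snd Y - snd X) - (snd V - snd U) * (fst Y - fst X).

Ltac coords := unfold line, parallel, area2, inner, cross in *; cbn [fst snd] in *.

Lemma sqr_sum_pos (x y : R) : x <> 0 \/ y <> 0 -> 0 < x * x + y * y.
Proof. intros [H | H]; nra. Qed.

Lemma inner_self_pos (U V : point) : U <> V -> 0 < inner U V U V.
Proof.
  destruct U as [u1 u2], V as [v1 v2]; intros H; coords.
  apply sqr_sum_pos.
  destruct (Req_dec (v1 - u1) 0) as [H1 | H1]; [right | now left].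
  intros H2; apply H; f_equal; lra.
Qed.

Lemma circle_inner (K X : point) (r : R) :
  0 < r -> circle K r X <-> inner K X K X = r * r.
Proof.
  destruct K as [k1 k2], X as [x1 x2]; intros Hr.
  unfold circle, Defs.dist, dist_euc; coords; unfold Rsqr.
  split; intros H.
  - rewrite <- H, sqrt_sqrt; [ring | ].
    apply Rplus_le_le_0_compat; apply Rle_0_sqr.
  - replace (_ + _) with (r * r) by lra.
    apply sqrt_square; lra.
Qed.

(** [Y'] is the mirror image of [Y] in the perpendicular from [K] to the line [UV]. It coincides
    with [Y] at a point of tangency, so secants and tangents are treated alike. *)
Lemma circle_line_reflection (K U V Y : point) (r : R) :
  0 < r -> U <> V -> circle K r Y -> line U V Y ->
  exists Y', circle K r Y' /\ line U V Y' /\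
    inner U V K Y + inner U V K Y' = 0.
Proof.
  intros Hr HUV HY HL.
  pose proof (inner_self_pos _ _ HUV) as Hp.
  apply circle_inner in HY; [ | exact Hr].
  set (m := 2 * inner U V Y K / inner U V U V).
  assert (Hm : m * inner U V U V = 2 * inner U V Y K) by (unfold m; field; lra).
  clearbody m.
  exists (fst Y + m * (fst V - fst U), snd Y + m * (snd V - snd U)).
  rewrite circle_inner by exact Hr.
  destruct K as [k1 k2], U as [u1 u2], V as [v1 v2], Y as [y1 y2]; coords.
  repeat split; [ | lra | lra].
  pose proof (f_equal (Rmult m) Hm); lra.
Qed.

Lemma meet_circle_line_midpoint (O U V X Y : point) (r : R) :
  0 < r -> U <> V -> meet_in (circle O r) (line U V) X Y ->
  line U V X /\ line U V Y /\ inner U V O X + inner U V O Y = 0.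
Proof.
  intros Hr HUV H.
  destruct (proj2 (H X) (or_introl eq_refl)) as [HX HXl].
  destruct (proj2 (H Y) (or_intror eq_refl)) as [HY HYl].
  repeat split; [exact HXl | exact HYl | ].
  destruct (circle_line_reflection _ _ _ _ _ Hr HUV HX HXl) as (X' & c1 & l1 & e1).
  destruct (circle_line_reflection _ _ _ _ _ Hr HUV HY HYl) as (Y' & c2 & l2 & e2).
  (* Either the reflection sends one of the two points to the other, or it fixes both, and then both
     are the foot of the perpendicular from [O]. *)
  destruct (proj1 (H X') (conj c1 l1)) as [-> | ->]; [ | exact e1].
  destruct (proj1 (H Y') (conj c2 l2)) as [-> | ->]; lra.
Qed.

Lemma line_param (U V X : point) :
  U <> V -> line U V X ->
  exists m, X = (fst U + m * (fst V - fst U), snd U + m * (snd V - snd U)).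
Proof.
  intros HUV HX.
  pose proof (inner_self_pos _ _ HUV) as Hp.
  exists (inner U V U X / inner U V U V).
  destruct U as [u1 u2], V as [v1 v2], X as [x1 x2]; coords.
  f_equal; apply (Rmult_eq_reg_r
    ((v1 - u1) * (v1 - u1) + (v2 - u2) * (v2 - u2))); try lra; field_simplify; try lra.
  - pose proof (f_equal (Rmult (v2 - u2)) HX); lra.
  - pose proof (f_equal (Rmult (v1 - u1)) HX); lra.
Qed.

Lemma point_eq_dec (X Y : point) : X = Y \/ X <> Y.
Proof.
  destruct X as [x1 x2], Y as [y1 y2].
  destruct (Req_dec x1 y1), (Req_dec x2 y2);
    [left; subst; reflexivity | right; congruence ..].
Qed.

(** The foot of [K] halves the chord [VY]; on tangency this foot is [V] itself, so the limiting case
    obeys the same equation. *)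
Lemma chord_projection (K U V Y : point) (r : R) :
  0 < r -> V <> U -> circle K r V -> circle K r Y -> line V U Y ->
  (Y = V -> tangent_at (circle K r) (line V U) V) ->
  inner V U V Y = 2 * inner V U V K.
Proof.
  intros Hr HVU HV HY HL Ht.
  destruct (point_eq_dec Y V) as [E | E].
  - assert (HVl : line V U V) by (coords; ring).
    destruct (circle_line_reflection _ _ _ _ _ Hr HVU HV HVl) as (V' & c & l & e).
    rewrite (proj1 (Ht E V') (conj c l)) in e; subst Y.
    coords; lra.
  - apply circle_inner in HV, HY; try exact Hr.
    destruct (line_param _ _ _ HVU HL) as [m ->].
    apply (Rmult_eq_reg_l m).
    + destruct K as [k1 k2], U as [u1 u2], V as [v1 v2]; coords; lra.
    + intros ->; apply E; destruct V; cbn; f_equal; ring.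
Qed.

(** * Directed angles at a Miquel point *)

Lemma noncollinear_neq (U V W : point) :
  area2 U V W <> 0 -> U <> V /\ V <> W /\ W <> U.
Proof.
  intros H; repeat split; intros ->; apply H; coords; ring.
Qed.

(* Directed form of the inscribed angle theorem: XY makes with VU the same
   angle as XZ with VW. *)
Lemma vertex_circle_angle (V U W Y Z X : point) :
  area2 V U W <> 0 -> line V U Y -> line V W Z -> vertex_circle V U W Y Z X ->
  inner V U Y X * cross V W V X = inner V W Z X * cross V U V X.
Proof.
  intros Hn HY HZ (K & r & Hr & cV & cY & cZ & tY & tZ & cX).
  destruct (noncollinear_neq _ _ _ Hn) as (n1 & _ & n2).
  assert (E1 := chord_projection _ _ _ _ _ Hr n1 cV cY HY tY).
  assert (E2 := chord_projection _ _ _ _ _ Hr (not_eq_sym n2) cV cZ HZ tZ).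
  apply circle_inner in cV, cX; try exact Hr.
  clear - E1 E2 cV cX.
  (* Let u, w, x be the vectors from [V] to [U], [W], [X]. The centre [K] is eliminated by the
     identity cross(w,x) u + cross(x,u) w + cross(u,w) x = 0. *)
  assert (E3 : inner V X V X = 2 * inner V X V K)
    by (destruct K, V, X; coords; lra).
  apply (f_equal (Rmult (cross V W V X))) in E1.
  apply (f_equal (Rmult (cross V U V X))) in E2.
  apply (f_equal (Rmult (cross V U V W))) in E3.
  clear cV cX.
  destruct K, U, V, Y, W, Z, X; coords; lra.
Qed.

(** The equal angles make the three scalar products proportional to the three signed areas at [P].
    These areas add up to [area2 A B C], so [t] is the quotient of the sums; no single area is
    divided by, and [P] may lie on a side line. *)
Lemma miquel_point_angle (A B C D E F P : point) :
  area2 A B C <> 0 -> line B C D -> line C A E -> line A B F ->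
  miquel_point A B C D E F P ->
  exists t,
    inner B C D P = t * cross B C D P /\
    inner C A E P = t * cross C A E P /\
    inner A B F P = t * cross A B F P /\
    t * area2 A B C = inner B C D P + inner C A E P + inner A B F P.
Proof.
  intros Hn HD HE HF (HA & HB & HC).
  apply vertex_circle_angle in HA, HB, HC;
    [ | intros e; apply Hn; coords; lra | coords; lra | coords; lra
      | intros e; apply Hn; coords; lra | coords; lra | coords; lra
      | intros e; apply Hn; coords; lra | coords; lra | coords; lra ].
  assert (G1 : cross B C D P = area2 B C P) by (coords; lra).
  assert (G2 : cross C A E P = area2 C A P) by (coords; lra).
  assert (G3 : cross A B F P = area2 A B P) by (coords; lra).
  rewrite G1, G2, G3; clear G1 G2 G3 HD HE HF.
  exists ((inner B C D P + inner C A E P + inner A B F P) / area2 A B C).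
  set (t := _ / _).
  assert (Ht : t * area2 A B C = inner B C D P + inner C A E P + inner A B F P)
    by (unfold t; field; exact Hn).
  clearbody t.
  assert (S1 : inner B C D P * area2 C A P = inner C A E P * area2 B C P)
    by (coords; lra).
  assert (S2 : inner C A E P * area2 A B P = inner A B F P * area2 C A P)
    by (coords; lra).
  assert (S3 : inner A B F P * area2 B C P = inner B C D P * area2 A B P)
    by (coords; lra).
  assert (Hs : area2 A B C = area2 B C P + area2 C A P + area2 A B P)
    by (coords; ring).
  clear HA HB HC.
  repeat split; [ .. | exact Ht];
    apply (Rmult_eq_reg_l (area2 A B C)); try exact Hn;
    [ apply (f_equal (Rmult (area2 B C P))) in Ht
    | apply (f_equal (Rmult (area2 C A P))) in Ht
    | apply (f_equal (Rmult (area2 A B P))) in Ht ];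
    rewrite Hs in Ht |- *; lra.
Qed.

(** * Equations of the vertex circles; feet of the perpendiculars from [O] *)

Lemma line_slope (U V D X T : point) (t : R) :
  X <> D -> line X D T ->
  inner U V D X = t * cross U V D X -> inner U V X T = t * cross U V X T.
Proof.
  intros HXD HT H.
  destruct (line_param _ _ _ HXD HT) as [m ->].
  apply (f_equal (Rmult m)) in H.
  destruct U, V, D, X; coords; lra.
Qed.

(* In the frame centred at the vertex V, twice the centre of the circle is
   p + t i p, where p = P - V. *)
Lemma vertex_circle_equation (V U W Y Z P : point) (t : R) :
  area2 V U W <> 0 -> line V U Y -> line V W Z ->
  inner V U Y P = t * cross V U Y P ->
  inner V W Z P = t * cross V W Z P ->
  vertex_circle V U W Y Z P ->
  forall X, vertex_circle V U W Y Z X <->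
    inner V X V X = inner V P V X + t * cross V P V X.
Proof.
  intros Hn HY HZ eY eZ HP.
  destruct (noncollinear_neq _ _ _ Hn) as (n1 & _ & n2%not_eq_sym).
  (* Stated for every admissible circle: one implication meets an arbitrary witness, the converse
     reuses the witness for [P]. *)
  assert (Hc : forall K r, 0 < r -> circle K r V -> circle K r Y -> circle K r Z ->
    (Y = V -> tangent_at (circle K r) (line V U) V) ->
    (Z = V -> tangent_at (circle K r) (line V W) V) ->
    forall X, circle K r X <->
      inner V X V X = inner V P V X + t * cross V P V X).
  { intros K r Hr cV cY cZ tY tZ X.
    assert (E1 := chord_projection _ _ _ _ _ Hr n1 cV cY HY tY).
    assert (E2 := chord_projection _ _ _ _ _ Hr n2 cV cZ HZ tZ).
    rewrite circle_inner by exact Hr; apply circle_inner in cV; [ | exact Hr].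
    (* [F1] and [F2] give 2(K - V) = p + t i p along the independent directions [VU] and [VW]. *)
    assert (F1 : inner V U V P - t * cross V U V P = 2 * inner V U V K)
      by (destruct V, U, Y, P, K; coords; clear - E1 eY HY;
          apply (f_equal (Rmult t)) in HY; lra).
    assert (F2 : inner V W V P - t * cross V W V P = 2 * inner V W V K)
      by (destruct V, W, Z, P, K; coords; clear - E2 eZ HZ;
          apply (f_equal (Rmult t)) in HZ; lra).
    clear - Hn F1 F2 cV.
    destruct V as [v1 v2], U as [u1 u2], W as [w1 w2], P as [p1 p2],
      K as [k1 k2], X as [x1 x2]; coords.
    assert (G1 : 2 * (k1 - v1) = (p1 - v1) - t * (p2 - v2)).
    { apply (Rmult_eq_reg_l _ _ _) with (2 := Hn).
      apply (f_equal (Rmult (w2 - v2))) in F1.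
      apply (f_equal (Rmult (u2 - v2))) in F2. lra. }
    assert (G2 : 2 * (k2 - v2) = (p2 - v2) + t * (p1 - v1)).
    { apply (Rmult_eq_reg_l _ _ _) with (2 := Hn).
      apply (f_equal (Rmult (w1 - v1))) in F1.
      apply (f_equal (Rmult (u1 - v1))) in F2. lra. }
    apply (f_equal (Rmult (x1 - v1))) in G1.
    apply (f_equal (Rmult (x2 - v2))) in G2.
    split; intros H; lra. }
  intros X; split.
  - intros (K & r & Hr & cV & cY & cZ & tY & tZ & cX).
    now apply (Hc K r).
  - intros HX.
    destruct HP as (K & r & Hr & cV & cY & cZ & tY & tZ & _).
    exists K, r; repeat (split; [assumption | ]).
    now apply (Hc K r).
Qed.

(* [miquel_frame t P Q O N]: O and N are the antipodal points of the circle
   through P and Q for which the directed angle POQ is 2 theta, cot theta = t. *)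
Definition miquel_frame (t : R) (P Q O N : point) : Prop :=
  2 * fst O = fst P + fst Q - t * (snd P - snd Q) /\
  2 * snd O = snd P + snd Q + t * (fst P - fst Q) /\
  t * (2 * fst N - fst P - fst Q) = snd P - snd Q /\
  t * (2 * snd N - snd P - snd Q) = - (fst P - fst Q).

(** On each side the relations for [P] and [Q] are added and the midpoint is replaced by the foot of
    [O]. This gives the components of P + Q - 2O along two independent sides, which determine [O];
    [N] is solved from its own two equations. *)
Lemma miquel_frame_exists (A B C A1 A2 B1 B2 P Q O : point) (t : R) :
  area2 A B C <> 0 -> t <> 0 ->
  line B C A1 -> line B C A2 -> inner B C O A1 + inner B C O A2 = 0 ->
  line C A B1 -> line C A B2 -> inner C A O B1 + inner C A O B2 = 0 ->
  inner B C A1 P = t * cross B C A1 P -> inner B C A2 Q = - t * cross B C A2 Q ->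
  inner C A B1 P = t * cross C A B1 P -> inner C A B2 Q = - t * cross C A B2 Q ->
  exists N, miquel_frame t P Q O N.
Proof.
  intros Hn Ht a1 a2 ma b1 b2 mb pa qa pb qb.
  exists ((fst P + fst Q) / 2 + (snd P - snd Q) / (2 * t),
     (snd P + snd Q) / 2 - (fst P - fst Q) / (2 * t)).
  assert (H1 : inner B C O P + inner B C O Q = t * cross B C Q P).
  { apply (f_equal (Rmult t)) in a1, a2.
    destruct B, C, A1, A2, P, Q, O; coords; lra. }
  assert (H2 : inner C A O P + inner C A O Q = t * cross C A Q P).
  { apply (f_equal (Rmult t)) in b1, b2.
    destruct C, A, B1, B2, P, Q, O; coords; lra. }
  clear - Hn Ht H1 H2.
  destruct A as [a1 a2], B as [b1 b2], C as [c1 c2], P as [p1 p2],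
    Q as [q1 q2], O as [o1 o2]; unfold miquel_frame; coords.
  repeat split; [ | | field; exact Ht | field; exact Ht];
    apply (Rmult_eq_reg_l _ _ _) with (2 := Hn).
  - apply (f_equal (Rmult (a2 - c2))) in H1.
    apply (f_equal (Rmult (c2 - b2))) in H2. lra.
  - apply (f_equal (Rmult (a1 - c1))) in H1.
    apply (f_equal (Rmult (c1 - b1))) in H2. lra.
Qed.

(** [TP] and [TQ] make opposite angles with [UV], so the bisectors at [T] are perpendicular and
    parallel to [UV]; they pass through the arc midpoints [O] and [N]. Algebraically, these are the
    sum and the difference of the two slope relations. *)
Lemma isosceles_apex_foot (U V P Q O N T : point) (t : R) :
  t <> 0 -> miquel_frame t P Q O N ->
  inner U V P T = t * cross U V P T -> inner U V Q T = - t * cross U V Q T ->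
  inner U V O T = 0 /\ cross U V N T = 0.
Proof.
  intros Ht (o1 & o2 & n1 & n2) H1 H2.
  split; [ | apply (Rmult_eq_reg_l t _ _); [ | exact Ht] ];
    apply (f_equal (Rmult (fst V - fst U))) in o1 as o1';
    apply (f_equal (Rmult (snd V - snd U))) in o2 as o2';
    apply (f_equal (Rmult (snd V - snd U))) in n1 as n1';
    apply (f_equal (Rmult (fst V - fst U))) in n2 as n2';
    clear - H1 H2 o1' o2' n1' n2'; destruct U, V, P, Q, O, N, T; coords; lra.
Qed.

(** The two circle equations differ by exchanging [P] with [Q] and [t] with [- t]. Their difference
    is the line [VN], their half-sum the circle with diameter [VO]. *)
Lemma second_intersection_foot (V U W Y1 Z1 Y2 Z2 P Q O N X : point) (t : R) :
  area2 V U W <> 0 -> t <> 0 -> miquel_frame t P Q O N ->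
  line V U Y1 -> line V W Z1 -> line V U Y2 -> line V W Z2 ->
  inner V U Y1 P = t * cross V U Y1 P -> inner V W Z1 P = t * cross V W Z1 P ->
  inner V U Y2 Q = - t * cross V U Y2 Q -> inner V W Z2 Q = - t * cross V W Z2 Q ->
  vertex_circle V U W Y1 Z1 P -> vertex_circle V U W Y2 Z2 Q ->
  second_intersection (vertex_circle V U W Y1 Z1) (vertex_circle V U W Y2 Z2) V X ->
  N <> V /\ inner N V O X = 0 /\ cross N V N X = 0.
Proof.
  intros Hn Ht (o1 & o2 & n1 & n2) Y1l Z1l Y2l Z2l eY1 eZ1 eY2 eZ2 cP cQ [HXV HX].
  assert (E1 := vertex_circle_equation _ _ _ _ _ _ _ Hn Y1l Z1l eY1 eZ1 cP).
  assert (E2 := vertex_circle_equation _ _ _ _ _ _ _ Hn Y2l Z2l eY2 eZ2 cQ).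
  assert (H : forall Z, inner V Z V Z = inner V P V Z + t * cross V P V Z /\
      inner V Z V Z = inner V Q V Z + - t * cross V Q V Z <-> Z = V \/ Z = X)
    by (intros Z; rewrite <- E1, <- E2; apply HX).
  destruct (proj2 (H X) (or_intror eq_refl)) as [X1 X2].
  assert (HNV : N <> V).
  { (* If N = V the two circles coincide, and a circle has more than two points. *)
    intros ->.
    set (k1 := (fst P - fst V) - t * (snd P - snd V)).
    set (k2 := (snd P - snd V) + t * (fst P - fst V)).
    assert (HZ : forall z1 z2, z1 * z1 + z2 * z2 = k1 * z1 + k2 * z2 ->
      (fst V + z1, snd V + z2) = V \/ (fst V + z1, snd V + z2) = X).
    { intros z1 z2 Hz; apply H; subst k1 k2.
      apply (f_equal (Rmult z1)) in n2.
      apply (f_equal (Rmult z2)) in n1.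
      clear - n1 n2 Hz; destruct V, P, Q; coords; split; lra. }
    (* In complex notation k is twice the centre relative to [V]. The points V, V + k and V + (1 +
       i) k / 2 of the common circle are distinct unless k = 0, and then the circle shrinks to [V],
       leaving no room for [X]. *)
    assert (Hk : k1 = 0 /\ k2 = 0).
    { destruct (HZ k1 k2 eq_refl) as [e | e].
      - destruct V; injection e; intros; split; lra.
      - destruct (HZ ((k1 - k2) / 2) ((k2 + k1) / 2)) as [f | f]; [field | | ].
        + destruct V; injection f; intros; split; lra.
        + rewrite <- e in f; injection f; intros; split; lra. }
    apply HXV; symmetry in X1; clear - HXV X1 Hk.
    destruct Hk as [e1 e2]; subst k1 k2.
    apply (f_equal (Rmult (fst X - fst V))) in e1.
    apply (f_equal (Rmult (snd X - snd V))) in e2.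
    pose proof (inner_self_pos _ _ (not_eq_sym HXV)).
    destruct V, P, X; coords; lra. }
  assert (Hc : cross V N V X = 0).
  { apply (Rmult_eq_reg_l t _ _); [ | exact Ht].
    apply (f_equal (Rmult (snd X - snd V))) in n1.
    apply (f_equal (Rmult (fst X - fst V))) in n2.
    clear - n1 n2 X1 X2; destruct V, N, P, Q, X; coords; lra. }
  assert (Ho : inner V X O X = 0).
  { apply (f_equal (Rmult (fst X - fst V))) in o1.
    apply (f_equal (Rmult (snd X - snd V))) in o2.
    clear - o1 o2 X1 X2; destruct V, O, P, Q, X; coords; lra. }
  split; [exact HNV | ].
  clear - HXV HNV Hc Ho.
  assert (Hl : line V N X) by exact Hc.
  destruct (line_param _ _ _ (not_eq_sym HNV) Hl) as [m ->].
  split; [ | destruct V, N; coords; ring].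
  apply (Rmult_eq_reg_l m _ _).
  - destruct V, N, O; coords; lra.
  - intros ->; apply HXV; destruct V; cbn; f_equal; ring.
Qed.

(** * Concurrency from linearly dependent equations *)

Lemma orthogonal_cross (a b x1 x2 y1 y2 : R) :
  a <> 0 \/ b <> 0 -> a * x1 + b * x2 = 0 -> a * y1 + b * y2 = 0 ->
  x1 * y2 - x2 * y1 = 0.
Proof.
  intros [Ha | Hb] Hx Hy.
  - apply (f_equal (Rmult y2)) in Hx; apply (f_equal (Rmult x2)) in Hy.
    apply (Rmult_eq_reg_l a); [lra | exact Ha].
  - apply (f_equal (Rmult y1)) in Hx; apply (f_equal (Rmult x1)) in Hy.
    apply (Rmult_eq_reg_l b); [lra | exact Hb].
Qed.

(** If the first two normals are independent, the common zero of the first two forms annuls the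
    third. Otherwise all three normals are proportional and the lines are parallel. *)
Lemma concurrent_of_affine_forms (a1 b1 c1 a2 b2 c2 a3 b3 c3 : R)
  (U1 V1 U2 V2 U3 V3 : point) :
  a1 + a2 + a3 = 0 -> b1 + b2 + b3 = 0 -> c1 + c2 + c3 = 0 ->
  (a1 <> 0 \/ b1 <> 0) -> (a2 <> 0 \/ b2 <> 0) -> (a3 <> 0 \/ b3 <> 0) ->
  a1 * fst U1 + b1 * snd U1 + c1 = 0 -> a1 * fst V1 + b1 * snd V1 + c1 = 0 ->
  a2 * fst U2 + b2 * snd U2 + c2 = 0 -> a2 * fst V2 + b2 * snd V2 + c2 = 0 ->
  a3 * fst U3 + b3 * snd U3 + c3 = 0 -> a3 * fst V3 + b3 * snd V3 + c3 = 0 ->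
  concurrent U1 V1 U2 V2 U3 V3.
Proof.
  intros Ha Hb Hc N1 N2 N3 u1 v1 u2 v2 u3 v3.
  assert (D : forall a b c (U V : point), a * fst U + b * snd U + c = 0 ->
    a * fst V + b * snd V + c = 0 ->
    a * (fst V - fst U) + b * (snd V - snd U) = 0) by (intros; lra).
  destruct (Req_dec (a1 * b2 - a2 * b1) 0) as [E | E].
  - right.
    assert (Hd : forall a b d1 d2, (a <> 0 \/ b <> 0) -> a * d1 + b * d2 = 0 ->
      a1 * b - a * b1 = 0 -> a1 * d1 + b1 * d2 = 0).
    { intros a b d1 d2 Hn Hd He.
      assert (He' : a * - b1 + b * a1 = 0) by lra.
      pose proof (orthogonal_cross _ _ _ _ _ _ Hn Hd He'); lra. }
    assert (E3 : a1 * b3 - a3 * b1 = 0)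
      by (replace a3 with (- a1 - a2) by lra;
          replace b3 with (- b1 - b2) by lra; lra).
    pose proof (D _ _ _ _ _ u1 v1) as d1.
    pose proof (Hd _ _ _ _ N2 (D _ _ _ _ _ u2 v2) E) as d2.
    pose proof (Hd _ _ _ _ N3 (D _ _ _ _ _ u3 v3) E3) as d3.
    unfold parallel.
    repeat split; apply (orthogonal_cross a1 b1); assumption.
  - left.
    set (X := ((b1 * c2 - b2 * c1) / (a1 * b2 - a2 * b1),
               (a2 * c1 - a1 * c2) / (a1 * b2 - a2 * b1)) : point).
    assert (x1 : a1 * fst X + b1 * snd X + c1 = 0)
      by (unfold X; cbn [fst snd]; field; exact E).
    assert (x2 : a2 * fst X + b2 * snd X + c2 = 0)
      by (unfold X; cbn [fst snd]; field; exact E).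
    assert (x3 : a3 * fst X + b3 * snd X + c3 = 0)
      by (replace a3 with (- a1 - a2) by lra;
          replace b3 with (- b1 - b2) by lra; lra).
    clearbody X.
    assert (L : forall a b c (U V : point), (a <> 0 \/ b <> 0) ->
      a * fst U + b * snd U + c = 0 -> a * fst V + b * snd V + c = 0 ->
      a * fst X + b * snd X + c = 0 -> line U V X).
    { intros a b c U V Hn HU HV HX; unfold line, area2.
      apply (orthogonal_cross a b); [exact Hn | lra | lra]. }
    exists X; eauto 10.
Qed.

(** * Equations of the chords joining two feet *)

Definition vec (U V : point) : point := (fst V - fst U, snd V - snd U).

(* [chord_x], [chord_y] and [chord_0] are the coefficients of the chord through
   the feet of the perpendiculars from o to the lines through the origin of
   directions p and q.  In complex notation the chord is
   Re (conj ((2 z - o) o) p q) = |o|^2 Re (conj p q); it is bilinear in (p, q). *)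
Definition chord_x (o p q : point) : R :=
  2 * (fst o * (fst p * fst q - snd p * snd q)
       + snd o * (fst p * snd q + snd p * fst q)).

Definition chord_y (o p q : point) : R :=
  2 * (fst o * (fst p * snd q + snd p * fst q)
       - snd o * (fst p * fst q - snd p * snd q)).

Definition chord_0 (o p q : point) : R :=
  - (fst o * chord_x o p q + snd o * chord_y o p q) / 2
  - (fst o * fst o + snd o * snd o) * (fst p * fst q + snd p * snd q).

(** The constant term after moving the origin from [N] back to that of the plane. *)
Definition chord_c (N o p q : point) : R :=
  chord_0 o p q - (fst N * chord_x o p q + snd N * chord_y o p q).

(** With origin [N], the foot z on direction p satisfies 2z - o = conj(o) p / conj(p). Substituting
    this turns the chord equation into an identity in q. *)
Lemma chord_foot (N O U V q T : point) :
  U <> V -> inner U V O T = 0 -> cross U V N T = 0 ->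
  chord_x (vec N O) (vec U V) q * fst T + chord_y (vec N O) (vec U V) q * snd T
  + chord_c N (vec N O) (vec U V) q = 0.
Proof.
  intros HUV Ho Hc.
  apply (Rmult_eq_reg_l (inner U V U V));
    [ | pose proof (inner_self_pos _ _ HUV); lra].
  set (p1 := fst V - fst U); set (p2 := snd V - snd U).
  set (o1 := fst O - fst N); set (o2 := snd O - snd N).
  set (z1 := fst T - fst N); set (z2 := snd T - snd N).
  assert (Ho' : p1 * z1 + p2 * z2 = p1 * o1 + p2 * o2)
    by (unfold inner in Ho; subst p1 p2 o1 o2 z1 z2; lra).
  assert (Hc' : p1 * z2 - p2 * z1 = 0) by exact Hc.
  assert (F1 : (p1 * p1 + p2 * p2) * z1 = p1 * (p1 * o1 + p2 * o2))
    by (apply (f_equal (Rmult p1)) in Ho'; apply (f_equal (Rmult p2)) in Hc'; lra).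
  assert (F2 : (p1 * p1 + p2 * p2) * z2 = p2 * (p1 * o1 + p2 * o2))
    by (apply (f_equal (Rmult p2)) in Ho'; apply (f_equal (Rmult p1)) in Hc'; lra).
  replace (fst T) with (fst N + z1) by (unfold z1; ring).
  replace (snd T) with (snd N + z2) by (unfold z2; ring).
  unfold chord_c, chord_0.
  apply (f_equal (Rmult (chord_x (o1, o2) (p1, p2) q))) in F1.
  apply (f_equal (Rmult (chord_y (o1, o2) (p1, p2) q))) in F2.
  unfold chord_x, chord_y, vec, inner in *; cbn [fst snd] in *.
  fold p1 p2 o1 o2 in F1, F2 |- *.
  clearbody p1 p2 o1 o2 z1 z2; lra.
Qed.

Lemma chord_swap (N o p q : point) :
  chord_x o p q = chord_x o q p /\ chord_y o p q = chord_y o q p /\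
  chord_c N o p q = chord_c N o q p.
Proof.
  unfold chord_c, chord_0, chord_x, chord_y; repeat split; field.
Qed.

(** The normal of the chord is the complex number 2 conj(o) p q, a product of nonzero factors. *)
Lemma chord_nonzero (N O U V W : point) :
  N <> O -> U <> V -> N <> W ->
  chord_x (vec N O) (vec U V) (vec N W) <> 0 \/
  chord_y (vec N O) (vec U V) (vec N W) <> 0.
Proof.
  intros HO HUV HW.
  apply inner_self_pos in HO, HUV, HW.
  destruct (Req_dec (chord_x (vec N O) (vec U V) (vec N W)) 0) as [Ex | ];
    [ | now left].
  right; intros Ey.
  assert (H : inner N O N O * (inner U V U V * inner N W N W) = 0).
  { transitivity ((chord_x (vec N O) (vec U V) (vec N W) *
                   chord_x (vec N O) (vec U V) (vec N W) +
                   chord_y (vec N O) (vec U V) (vec N W) *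
                   chord_y (vec N O) (vec U V) (vec N W)) / 4).
    - unfold chord_x, chord_y, vec, inner; cbn [fst snd]; field.
    - rewrite Ex, Ey; field. }
  pose proof (Rmult_lt_0_compat _ _ HO (Rmult_lt_0_compat _ _ HUV HW)); lra.
Qed.

Lemma foot_unique (N U V T : point) :
  U <> V -> inner U V N T = 0 -> cross U V N T = 0 -> T = N.
Proof.
  intros HUV Ho Hc.
  pose proof (inner_self_pos _ _ HUV) as Hp.
  destruct N as [n1 n2], U as [u1 u2], V as [v1 v2], T as [t1 t2]; coords.
  f_equal; apply (Rmult_eq_reg_l _ _ _) with (2 := Rgt_not_eq _ _ Hp).
  - apply (f_equal (Rmult (v1 - u1))) in Ho.
    apply (f_equal (Rmult (v2 - u2))) in Hc. lra.
  - apply (f_equal (Rmult (v2 - u2))) in Ho.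
    apply (f_equal (Rmult (v1 - u1))) in Hc. lra.
Qed.

Lemma feet_perspective (A B C N O TA TB TC A' B' C' : point) :
  area2 A B C <> 0 -> N <> A -> N <> B -> N <> C ->
  inner B C O TA = 0 -> cross B C N TA = 0 ->
  inner C A O TB = 0 -> cross C A N TB = 0 ->
  inner A B O TC = 0 -> cross A B N TC = 0 ->
  inner N A O A' = 0 -> cross N A N A' = 0 ->
  inner N B O B' = 0 -> cross N B N B' = 0 ->
  inner N C O C' = 0 -> cross N C N C' = 0 ->
  TA <> A' -> TB <> B' -> TC <> C' -> perspective TA TB TC A' B' C'.
Proof.
  intros Hn NA NB NC ta1 ta2 tb1 tb2 tc1 tc2 a1 a2 b1 b2 c1 c2 dA dB dC.
  destruct (noncollinear_neq _ _ _ Hn) as (nAB & nBC & nCA).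
  (* If [N] were [O], the feet [TA] and [A'] would both be [N]. *)
  assert (NO : N <> O).
  { intros <-; apply dA.
    rewrite (foot_unique _ _ _ _ nBC ta1 ta2).
    now rewrite (foot_unique _ _ _ _ NA a1 a2). }
  assert (F : forall U V W X, N <> W -> inner N W O X = 0 -> cross N W N X = 0 ->
    chord_x (vec N O) (vec U V) (vec N W) * fst X +
    chord_y (vec N O) (vec U V) (vec N W) * snd X +
    chord_c N (vec N O) (vec U V) (vec N W) = 0).
  { intros U V W X HW H1 H2.
    destruct (chord_swap N (vec N O) (vec U V) (vec N W)) as (-> & -> & ->).
    now apply chord_foot. }
  unfold perspective.
  apply (concurrent_of_affine_forms
    (chord_x (vec N O) (vec B C) (vec N A)) (chord_y (vec N O) (vec B C) (vec N A))
    (chord_c N (vec N O) (vec B C) (vec N A))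
    (chord_x (vec N O) (vec C A) (vec N B)) (chord_y (vec N O) (vec C A) (vec N B))
    (chord_c N (vec N O) (vec C A) (vec N B))
    (chord_x (vec N O) (vec A B) (vec N C)) (chord_y (vec N O) (vec A B) (vec N C))
    (chord_c N (vec N O) (vec A B) (vec N C)));
    try (apply chord_nonzero; assumption);
    try (apply chord_foot; assumption); try (apply F; assumption);
    (* What remains is that the three forms add up to zero, by bilinearity and the symmetric product
       identity. *)
    unfold chord_c, chord_0, chord_x, chord_y, vec; cbn [fst snd]; field.
Qed.

Theorem proposition4p4
  (A B C : point) (hABC : anticlockwise A B C)
  (O : point) (r : R) (hr : 0 < r)
  (A1 A2 B1 B2 C1 C2 : point)
  (hA12 : meet_in (circle O r) (line B C) A1 A2)
  (hB12 : meet_in (circle O r) (line C A) B1 B2)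
  (hC12 : meet_in (circle O r) (line A B) C1 C2)
  (hndA1 : ~ (B1 = A /\ C1 = A)) (hndA2 : ~ (B2 = A /\ C2 = A))
  (hndB1 : ~ (C1 = B /\ A1 = B)) (hndB2 : ~ (C2 = B /\ A2 = B))
  (hndC1 : ~ (A1 = C /\ B1 = C)) (hndC2 : ~ (A2 = C /\ B2 = C))
  (P Q : point)
  (hP : miquel_point A B C A1 B1 C1 P)
  (hQ : miquel_point A B C A2 B2 C2 Q)
  (hPQ : P <> Q)
  (hPA : P <> A1) (hPB : P <> B1) (hPC : P <> C1)
  (hQA : Q <> A2) (hQB : Q <> B2) (hQC : Q <> C2)
  (TA TB TC : point)
  (hTA : lines_intersection P A1 Q A2 TA)
  (hTB : lines_intersection P B1 Q B2 TB)
  (hTC : lines_intersection P C1 Q C2 TC)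
  (A' B' C' : point)
  (hA' : second_intersection
           (vertex_circle A C B B1 C1) (vertex_circle A C B B2 C2) A A')
  (hB' : second_intersection
           (vertex_circle B A C C1 A1) (vertex_circle B A C C2 A2) B B')
  (hC' : second_intersection
           (vertex_circle C B A A1 B1) (vertex_circle C B A A2 B2) C C')
  (hTA' : TA <> A') (hTB' : TB <> B') (hTC' : TC <> C') :
  perspective TA TB TC A' B' C'.
Proof.
  assert (Hn : area2 A B C <> 0) by (unfold anticlockwise in hABC; lra).
  destruct (noncollinear_neq _ _ _ Hn) as (nAB & nBC & nCA).
  apply meet_circle_line_midpoint in hA12 as (la1 & la2 & ma);
    [ | exact hr | exact nBC].
  apply meet_circle_line_midpoint in hB12 as (lb1 & lb2 & mb);
    [ | exact hr | exact nCA].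
  apply meet_circle_line_midpoint in hC12 as (lc1 & lc2 & mc);
    [ | exact hr | exact nAB].
  destruct (miquel_point_angle _ _ _ _ _ _ _ Hn la1 lb1 lc1 hP)
    as (t & pa & pb & pc & pt).
  destruct (miquel_point_angle _ _ _ _ _ _ _ Hn la2 lb2 lc2 hQ)
    as (t' & qa & qb & qc & qt).
  (* In the sum of [pt] and [qt] the terms in [P] and [Q] cancel because the side vectors add up to
     zero. The midpoint relations then replace the remaining points by [O], which cancels
     likewise. *)
  assert (Ht' : t' = - t).
  { apply (Rmult_eq_reg_r _ _ _) with (2 := Hn).
    destruct A, B, C, O, A1, A2, B1, B2, C1, C2, P, Q.
    clear - ma mb mc pt qt; coords; lra. }
  subst t'.
  destruct hTA as (npA & lpA & lqA), hTB as (npB & lpB & lqB),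
    hTC as (npC & lpC & lqC).
  assert (Ht : t <> 0).
  { intros ->; apply npA; unfold parallel.
    (* PA1 and QA2 are then both perpendicular to BC *)
    apply (orthogonal_cross (fst C - fst B) (snd C - snd B)).
    - destruct (Req_dec (fst C - fst B) 0) as [e | ]; [right | now left].
      intros f; apply nBC; destruct B, C; cbn in *; f_equal; lra.
    - clear - pa; coords; lra.
    - clear - qa; coords; lra. }
  destruct (miquel_frame_exists _ _ _ _ _ _ _ _ _ _ _ Hn Ht
    la1 la2 ma lb1 lb2 mb pa qa pb qb) as [N HN].
  destruct (isosceles_apex_foot _ _ _ _ _ _ _ _ Ht HN
    (line_slope _ _ _ _ _ _ hPA lpA pa) (line_slope _ _ _ _ _ _ hQA lqA qa)).
  destruct (isosceles_apex_foot _ _ _ _ _ _ _ _ Ht HN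
    (line_slope _ _ _ _ _ _ hPB lpB pb) (line_slope _ _ _ _ _ _ hQB lqB qb)).
  destruct (isosceles_apex_foot _ _ _ _ _ _ _ _ Ht HN
    (line_slope _ _ _ _ _ _ hPC lpC pc) (line_slope _ _ _ _ _ _ hQC lqC qc)).
  destruct hP as (vPA & vPB & vPC), hQ as (vQA & vQB & vQC).
  assert (flip : forall X Y Z W s,
    inner X Y Z W = s * cross X Y Z W -> inner Y X Z W = s * cross Y X Z W)
    by (intros X Y Z W s e; unfold inner, cross in *; lra).
  assert (lflip : forall X Y Z, line X Y Z -> line Y X Z)
    by (intros X Y Z e; unfold line, area2 in *; lra).
  destruct (second_intersection_foot A C B B1 C1 B2 C2 P Q O N A' t)
    as (? & ? & ?); auto.
  { intros e; apply Hn; unfold area2 in *; lra. }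
  destruct (second_intersection_foot B A C C1 A1 C2 A2 P Q O N B' t)
    as (? & ? & ?); auto.
  { intros e; apply Hn; unfold area2 in *; lra. }
  destruct (second_intersection_foot C B A A1 B1 A2 B2 P Q O N C' t)
    as (? & ? & ?); auto.
  { intros e; apply Hn; unfold area2 in *; lra. }
  now apply (feet_perspective A B C N O).
Qed.
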